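(* Let $I\in\widetilde Q$ be a compatible complex structure and $(h_1,h_2)$ a symplectic basis of $H$ such that $I(h_1\otimes e)=h_2\otimes e$ and $I(h_2\otimes e)=-h_1\otimes e$ for all $e\in E$. With respect to $(h_1,h_2)$, a subspace $U\subseteq V$ is pure $I$-complex if and only if $U=U^{F,T}$ with $F=p_1(U)$ and $T$ a complex structure on $F$ (i.e. $T:F\to F$, $T^2=-\mathrm{Id}$). In this case: (a) The map $\phi:(F,T^{-1})\to(U^{F,T},I)$, $f\mapsto h_1\otimes f+h_2\otimes Tf$, is an isomorphism of complex vector spaces. (b) The signature of the metric on $U$ is of type $(2p,2s,2q)$ with $2s=\dim\ker g|_U$, and $U$ is Hermitian if and only if $F$ is $g_F$-non degenerate. In this case $\phi:(F,T^{-1},g_F)\to(U,I,g|_U)$ is an isomorphism of Hermitian spaces; in particular $T^{-1}$ is $g_F$-skew-symmetric. (c) The Kaehler form of $(U,I)$ is given by $$\phi^*(g|_U\circ I)=g_F\circ T^{-1}=-\bigl(\omega^E|_F+\omega^E|_F(T\,\cdot,T\,\cdot)\bigr).$$ (d) The subspace $(U,I)$ is totally complex if and only if $F$ is $\omega^E$-symplectic and $T$ is $\omega^E|_F$-skew-symmetric. The condition that $T$ is $\omega^E|_F$-skew-symmetric is equivalent to $T$ preserving $\omega^E|_F$, i.e. $\omega^E(f,f')=\omega^E(Tf,Tf')$ for all $f,f'\in F$, and also equivalent to $g_F=-2\,\omega^E|_F\circ T$.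
   Context: $H$ is a real vector space of dimension $2$ with symplectic form $\omega^H$, $E$ a real vector space of dimension $2n$ with symplectic form $\omega^E$; $V=H\otimes E$ with $\widetilde Q=\mathfrak{sl}(H)\otimes\mathrm{Id}\subset\mathrm{End}(V)$ and $g=\omega^H\otimes\omega^E$, i.e. $g(h\otimes e,h'\otimes e')=\omega^H(h,h')\omega^E(e,e')$ (a neutral scalar product for which all elements of $\widetilde Q$ are skew-symmetric). A symplectic basis $(h_1,h_2)$ of $H$ is one with $\omega^H=h_1^*\wedge h_2^*$, i.e. $\omega^H(h_1,h_2)=1$. Given it, each $X\in V$ is uniquely $X=h_1\otimes e+h_2\otimes e'$, and $p_1(X)=e$, $p_2(X)=e'$. For a symplectic basis $(h_1,h_2)$, a subspace $F\subseteq E$ and a linear map $T:F\to E$, $U^{F,T}=\{h_1\otimes f+h_2\otimes Tf: f\in F\}$. With $\phi(f)=h_1\otimes f+h_2\otimes Tf$, $g_F=\phi^*(g|_U)$ is the (possibly degenerate) symmetric form on $F$ given by pulling back $g|_U$. A compatible complex structure is $I\in\widetilde Q$ with $I^2=-\mathrm{Id}$. An admissible basis of $\widetilde Q$ is a basis $(I,J,K)$ of pairwise anticommuting endomorphisms with $-I^2=J^2=K^2=\mathrm{Id}$, $IJ=K$. A subspace $U$ is $I$-complex, written $(U,I)$, if $IU\subseteq U$; an admissible basis $(I,J,K)$ containing $I$ is then called adapted. A subspace is para-quaternionic if it is invariant under all of $\widetilde Q$; a subspace $U$ is pure if it contains no nonzero para-quaternionic subspace. A complex subspace $(U,I)$ is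 Hermitian if $g|_U$ is non degenerate. A Hermitian complex subspace $(U,I)$ is totally complex if there is an adapted basis $(I,J,K)$ with $JU\perp U$ (equivalently $KU\perp U$). Signature $(a,b,c)$ means $a$ positive directions, $b=\dim$ of the kernel, $c$ negative directions. For a bilinear form $b$ and an endomorphism $S$, $(b\circ S)(x,y)=b(Sx,y)$; $S$ is $b$-skew-symmetric if $b(Sx,y)=-b(x,Sy)$ for all $x,y$. $F$ is $\omega^E$-symplectic if $\omega^E|_F$ is non degenerate. *)

(* Defs.v *)
From HB Require Import structures.
From mathcomp Require Import all_boot all_order all_algebra.
From mathcomp Require Import reals.

Set Implicit Arguments.
Unset Strict Implicit.
Unset Printing Implicit Defensive.
Import Order.TTheory GRing.Theory Num.Theory.
Local Open Scope ring_scope.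

(* Universal property: V is a tensor product of H and E, with t h e standing
   for h (x) e. *)
Definition is_tensor (R : realType) (H E V : vectType R)
    (t : {bilinear H -> E -> V}) : Prop :=
  forall (W : lmodType R) (f : {bilinear H -> E -> W}),
    (exists L : {linear V -> W}, forall h e, L (t h e) = f h e) /\
    (forall L L' : {linear V -> W},
       (forall h e, L (t h e) = f h e) ->
       (forall h e, L' (t h e) = f h e) -> L =1 L').

Definition symplectic_basis (R : realType) (H : vectType R)
    (wH : {skew_symmetric H}) (h1 h2 : H) : Prop :=
  basis_of fullv [:: h1; h2] /\ wH h1 h2 = 1.

Definition lftrace (R : realType) (H : vectType R) (a : 'End(H)) : R :=
  \tr (passmx.mxof (vbasis {:H}) (vbasis {:H}) a).

(* A \in Qtilde = sl(H) (x) Id *)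
Definition in_Qtilde (R : realType) (H E V : vectType R)
    (t : {bilinear H -> E -> V}) (A : 'End(V)) : Prop :=
  exists2 a : 'End(H), lftrace a = 0 & forall h e, A (t h e) = t (a h) e.

Definition complex_structure (R : realType) (W : vectType R) (J : 'End(W)) :
  Prop := (J \o J)%VF = - \1%VF.

Definition compatible_complex_structure (R : realType) (H E V : vectType R)
    (t : {bilinear H -> E -> V}) (I : 'End(V)) : Prop :=
  in_Qtilde t I /\ complex_structure I.

Definition admissible_basis (R : realType) (H E V : vectType R)
    (t : {bilinear H -> E -> V}) (I J K : 'End(V)) : Prop :=
  [/\
      free [:: I; J; K] /\
      (forall A : 'End(V), A \in <<[:: I; J; K]>>%VS <-> in_Qtilde t A),
      [/\ (I \o J)%VF = - (J \o I)%VF, (J \o K)%VF = - (K \o J)%VF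
        & (K \o I)%VF = - (I \o K)%VF],
      [/\ (I \o I)%VF = - \1%VF, (J \o J)%VF = \1%VF & (K \o K)%VF = \1%VF]
    & (I \o J)%VF = K].

Definition complex_subspace (R : realType) (V : vectType R)
    (U : {vspace V}) (I : 'End(V)) : Prop := (I @: U <= U)%VS.

Definition para_quaternionic (R : realType) (H E V : vectType R)
    (t : {bilinear H -> E -> V}) (W : {vspace V}) : Prop :=
  forall A : 'End(V), in_Qtilde t A -> (A @: W <= W)%VS.

Definition pure (R : realType) (H E V : vectType R)
    (t : {bilinear H -> E -> V}) (U : {vspace V}) : Prop :=
  forall W : {vspace V}, (W <= U)%VS -> para_quaternionic t W -> W = 0%VS.

Definition pullback (R : realType) (W V : vectType R) (f : 'Hom(W, V))
    (b : V -> V -> R) : W -> W -> R := fun x y => b (f x) (f y).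

Section PullbackHermitian.
Variables (R : realType) (W V : vectType R) (f : 'Hom(W, V)) (eps : bool)
  (b : {hermitian V for eps & idfun}).

Let pullback_linearl y :
  GRing.linear_for *%R ((pullback f b)^~ y : W -> R).
Proof. by move=> a x x'; rewrite /pullback linearP linearPl. Qed.

Let pullback_linearr x :
  GRing.linear_for (idfun \; *%R) (pullback f b x : W -> R).
Proof. by move=> a y y'; rewrite /pullback linearP linearPr. Qed.

HB.instance Definition _ :=
  bilinear_isBilinear.Build R W W R *%R (idfun \; *%R) (pullback f b)
    (conj (fun y => pullback_linearl y) (fun x => pullback_linearr x)).

Let pullback_herm x y :
  pullback f b x y = (-1) ^+ eps * idfun (pullback f b y x).
Proof. exact: hermitian_subproof. Qed.

HB.instance Definition _ :=
  isHermitianSesquilinear.Build R W eps idfun (pullback f b) pullback_herm.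

End PullbackHermitian.

Definition incl (R : realType) (V : vectType R) (U : {vspace V}) :
  'Hom(subvs_of U, V) := linfun (@vsval _ _ U).

Notation restr U b := (pullback (incl U) b).

(* (b o S)(x, y) = b (S x, y) *)
Definition form_comp (R : realType) (W : vectType R) (b : W -> W -> R)
    (S : 'End(W)) : W -> W -> R := fun x y => b (S x) y.

Definition skew_for (R : realType) (W : vectType R) (b : W -> W -> R)
    (S : 'End(W)) : Prop := forall x y, b (S x) y = - b x (S y).

(* pos positive, nul null and neg negative vectors in some (equivalently, by
   Sylvester's law of inertia, every) b-orthogonal basis of W. *)
Definition has_signature (R : realType) (W : vectType R) (b : W -> W -> R)
    (pos nul neg : nat) : Prop :=
  exists e : seq W,
    [/\ basis_of fullv e /\ {in e &, forall x y, x != y -> b x y = 0},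
        count (fun x => 0 < b x x) e = pos,
        count (fun x => b x x == 0) e = nul
      & count (fun x => b x x < 0) e = neg].

(* kernel of g|_U, as a subspace of subvs_of U *)
Notation kernel_on U g := (orthov (restr U g) fullv).

Definition hermitian_subspace (R : realType) (V : vectType R)
    (g : {symmetric V}) (U : {vspace V}) (I : 'End(V)) : Prop :=
  complex_subspace U I /\ nondegenerate (restr U g).

Definition totally_complex (R : realType) (H E V : vectType R)
    (t : {bilinear H -> E -> V}) (g : {symmetric V})
    (U : {vspace V}) (I : 'End(V)) : Prop :=
  hermitian_subspace g U I /\
  exists J K : 'End(V),
    admissible_basis t I J K /\ (J @: U <= orthov g U)%VS.

(* phi : (W, J) -> (U, I), where U is a subspace of V *)
Definition complex_iso (R : realType) (W V : vectType R) (J : 'End(W))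
    (U : {vspace V}) (I : 'End(V)) (phi : 'Hom(W, V)) : Prop :=
  [/\ complex_structure J,
      complex_structure I /\ complex_subspace U I,
      lker phi = 0%VS,
      limg phi = U
    & forall x, phi (J x) = I (phi x)].

Definition hermitian_iso (R : realType) (W V : vectType R)
    (J : 'End(W)) (gW : {symmetric W}) (U : {vspace V}) (I : 'End(V))
    (g : {symmetric V}) (phi : 'Hom(W, V)) : Prop :=
  [/\ complex_iso J U I phi,
      nondegenerate gW /\ skew_for gW J,
      hermitian_subspace g U I /\
        {in U &, forall x y, g (I x) y = - g x (I y)}
    & forall x y, g (phi x) (phi y) = gW x y].

Definition phi_map (R : realType) (H E V : vectType R)
    (t : {bilinear H -> E -> V}) (h1 h2 : H) (F : {vspace E})
    (T : 'Hom(subvs_of F, E)) : 'Hom(subvs_of F, V) :=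
  (linfun (t h1) \o incl F)%VF + (linfun (t h2) \o T)%VF.

Lemma phi_mapE (R : realType) (H E V : vectType R)
    (t : {bilinear H -> E -> V}) (h1 h2 : H) (F : {vspace E})
    (T : 'Hom(subvs_of F, E)) (f : subvs_of F) :
  phi_map t h1 h2 T f = t h1 (vsval f) + t h2 (T f).
Proof. by rewrite /phi_map add_lfunE !comp_lfunE !lfunE. Qed.

Definition UFT (R : realType) (H E V : vectType R)
    (t : {bilinear H -> E -> V}) (h1 h2 : H) (F : {vspace E})
    (T : 'Hom(subvs_of F, E)) : {vspace V} := limg (phi_map t h1 h2 T).

(* T : F -> F seen as a map F -> E *)
Notation ambient T := (incl _ \o T)%VF.

(* Main.v *)
Require Import Defs.
From HB Require Import structures.
From mathcomp Require Import all_boot all_order all_algebra.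
From mathcomp Require Import reals ring lra zify.

(* In coordinates X = h1 (x) x + h2 (x) y the metric is
   g(X, X') = wE(x, y') - wE(y, x'), I acts by (x, y) |-> (-y, x), and Qtilde by
   the traceless 2x2 matrices. A pure I-complex subspace contains no h2 (x) e
   with e <> 0, since together with its image under I it would span H (x) e;
   hence it is the graph of a map T over its projection F, and I-invariance of
   the graph says that T maps F to F with T^2 = -1. Parts (a), (c) and (d) then
   become identities for wE and T. For the signature, every non-null x splits
   off an orthogonal pair x, I x of equal norms, and the dimension is even. *)

Set Implicit Arguments.
Unset Strict Implicit.
Unset Printing Implicit Defensive.
Import Order.TTheory GRing.Theory Num.Theory.
Import passmx.
Local Open Scope ring_scope.

(** * Symmetric forms: non-null vectors and the radical *)

Section Symmetric.
Variables (R : realType) (W : vectType R) (b : {symmetric W}).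

Lemma sym_formC x y : b x y = b y x.
Proof. by rewrite hermC mul1r. Qed.

(** Polarization: if [b u v] is nonzero while [u] and [v] are null, then
    [b (u + v) (u + v) = 2 b u v] is nonzero. *)
Lemma exists_norm_neq0 (A : {vspace W}) :
  ~~ (A <= orthov b A)%VS -> exists2 x, x \in A & b x x != 0.
Proof.
case/subvPn => u uA /mem_orthovPn[v vA buv].
have [uu0|] := eqVneq (b u u) 0; last by exists u.
have [vv0|] := eqVneq (b v v) 0; last by exists v.
exists (u + v); first exact: rpredD.
by rewrite hnormD uu0 vv0 !add0r /= mul1r -mulr2n mulrn_eq0.
Qed.

Variable e : seq W.
Hypothesis e_basis : basis_of fullv e.
Hypothesis e_orth : {in e &, forall x y, x != y -> b x y = 0}.

(** Pairing a radical vector with a basis vector isolates one coordinate times the norm of that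
    basis vector, so only null basis vectors can occur. This ties the null count of a signature to
    the kernel. *)
Lemma dim_radical_orth_basis :
  \dim (orthov b fullv) = count (fun x => b x x == 0) e.
Proof.
have e_free := basis_free e_basis; have e_uniq := free_uniq e_free.
set e0 := [seq x <- e | b x x == 0].
suff -> : orthov b fullv = <<e0>>%VS.
  rewrite -size_filter; apply/eqP; exact: (filter_free _ e_free).
apply/eqP; rewrite eqEsubv; apply/andP; split; last first.
  apply/span_subvP => x; rewrite mem_filter => /andP[/eqP xx0 xe].
  rewrite mem_orthov_sym -(span_basis e_basis); apply/span_subvP => y ye.
  rewrite mem_orthov1; have [->|yx] := eqVneq y x; first by rewrite xx0.
  by rewrite e_orth.
apply/subvP => v /mem_orthovP v_rad.
have v_span : v \in <<in_tuple e>>%VS by rewrite (span_basis e_basis) memvf.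
rewrite (coord_span v_span); apply: rpred_sum => i _.
have ei : (in_tuple e)`_i \in e by exact: mem_nth.
have [ii0|iiN0] := eqVneq (b (in_tuple e)`_i (in_tuple e)`_i) 0.
  by apply/rpredZ/memv_span; rewrite mem_filter ii0 eqxx.
suff -> : coord (in_tuple e) i v = 0 by rewrite scale0r mem0v.
apply/eqP; move: (v_rad _ (memvf (in_tuple e)`_i)) => /eqP.
rewrite {1}(coord_span v_span) linear_sumlz (bigD1 i) //= big1 => [|j ji].
  by rewrite addr0 linearZl_LR mulf_eq0 (negPf iiN0) orbF.
rewrite linearZl_LR /= e_orth ?mulr0 ?mem_nth //.
by rewrite nth_uniq.
Qed.

End Symmetric.

(** * Complex structures and the parity of signatures *)

Section ComplexStructure.
Variables (R : realType) (W : vectType R) (J : 'End(W)).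
Hypothesis J_cplx : complex_structure J.

Lemma complex_structureE x : J (J x) = - x.
Proof. by rewrite -comp_lfunE J_cplx opp_lfunE id_lfunE. Qed.

(** Injectivity is what makes the total operation [^-1] a true inverse of [J]. *)
Lemma complex_structure_lker : lker J == 0%VS.
Proof.
apply/lker0P => x y Jxy; apply: oppr_inj.
by rewrite -!complex_structureE Jxy.
Qed.

Lemma complex_structure_inv : (J^-1)%VF = - J.
Proof.
apply/lfunP => x; rewrite opp_lfunE -[x in LHS]opprK -complex_structureE.
by rewrite linearN /= lker0_lfunK // complex_structure_lker.
Qed.

(* [det(J)^2 = (-1)^dim] must be nonnegative. *)
Lemma complex_structure_dim : exists m, \dim {:W} = (2 * m)%N.
Proof.
pose M := mxof (vbasis {:W}) (vbasis {:W}) J.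
have MM : M *m M = - 1%:M.
  have eb := vbasisP {:W}.
  rewrite -mxof_comp // [X in mxof _ _ X]J_cplx linearN /= mxof1 //.
  exact: basis_free eb.
exists (\dim {:W})./2; rewrite mul2n -[LHS]odd_double_half.
case: (boolP (odd _)) => // d_odd.
have := congr1 determinant MM; rewrite det_mulmx -scaleN1r detZ det1 mulr1.
rewrite -signr_odd d_odd expr1 => detM.
by have := sqr_ge0 (\det M); rewrite expr2 detM oppr_ge0 ler10.
Qed.

Variable b : {symmetric W}.
Hypothesis J_skew : skew_for b J.

Lemma skew_norm0 x : b x (J x) = 0.
Proof. by have := J_skew x x; rewrite sym_formC; lra. Qed.

Lemma skew_isom x y : b (J x) (J y) = b x y.
Proof. by rewrite J_skew complex_structureE linearNr opprK. Qed.

Let perp (A : {vspace W}) x := (A :&: orthov b <[x]> :&: orthov b <[J x]>)%VS.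

Let mem_perp A x y :
  (y \in perp A x) = [&& y \in A, b y x == 0 & b y (J x) == 0].
Proof. by rewrite !memv_cap !mem_orthov1 andbA. Qed.

(* Splitting off the plane spanned by a non-null [x] and [J x], both of the
   same norm, keeps the complement stable under [J]. *)
Lemma orth_basis_even (A : {vspace W}) : (J @: A <= A)%VS ->
  exists e p q, [/\ basis_of A e, {in e &, forall x y, x != y -> b x y = 0},
    count (fun x => 0 < b x x) e = (2 * p)%N
    & count (fun x => b x x < 0) e = (2 * q)%N].
Proof.
have [k] := ubnP (\dim A); elim: k A => // k IHk A A_dim JA.
have [A_null|/exists_norm_neq0[x xA xx]] := boolP (A <= orthov b A)%VS.
  have b0 u v : u \in vbasis A -> v \in vbasis A -> b u v = 0.
    by move=> /vbasis_mem uA /vbasis_mem vA; apply: (orthovP A_null).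
  exists (vbasis A), 0%N, 0%N; rewrite vbasisP; split=> //.
  - by move=> u v uA vA _; apply: b0.
  - by apply/eqP; rewrite -leqn0 leqNgt -has_count; apply/hasPn => u uA;
      rewrite b0 ?ltxx.
  - by apply/eqP; rewrite -leqn0 leqNgt -has_count; apply/hasPn => u uA;
      rewrite b0 ?ltxx.
have JxA : J x \in A by apply/(subvP JA)/memv_img.
have JxJx : b (J x) (J x) = b x x := skew_isom x x.
have Jxx : b (J x) x = 0 by rewrite sym_formC skew_norm0.
have xperp : x \notin perp A x by rewrite mem_perp (negPf xx) andbF.
have perpA : (perp A x <= A)%VS by rewrite /perp -capvA capvSl.
have [||e [p [q [eb eo ep eq]]]] := IHk (perp A x).
- rewrite -ltnS (leq_trans _ A_dim) // ltnS ltn_neqAle dimvS // andbT.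
  by apply: contraNN xperp => /eqP dimE; move: xA;
    rewrite (_ : perp A x = A) //; apply/eqP; rewrite eqEdim perpA dimE /=.
(* Stability: [b (J y) x = - b y (J x)] and [b (J y) (J x) = b y x] both vanish. *)
- apply/subvP => _ /memv_imgP[y yperp ->]; move: yperp.
  rewrite !mem_perp => /and3P[yA /eqP yx /eqP yJx].
  by rewrite skew_isom yx J_skew yJx oppr0 eqxx (subvP JA) ?memv_img.
have e_perp y : y \in e -> [/\ y \in A, b y x = 0 & b y (J x) = 0].
  by move=> /(basis_mem eb); rewrite mem_perp => /and3P[? /eqP ? /eqP ?].
exists [:: x, J x & e].
have orth_e : {in [:: x, J x & e] &, forall u v, u != v -> b u v = 0}.
  move=> u v; rewrite !inE.
  case/or3P => [/eqP->|/eqP->|ue]; case/or3P => [/eqP->|/eqP->|ve] //.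
  - by rewrite eqxx.
  - by rewrite skew_norm0.
  - by rewrite sym_formC; case: (e_perp v ve).
  - by rewrite eqxx.
  - by rewrite sym_formC; case: (e_perp v ve).
  - by case: (e_perp u ue).
  - by case: (e_perp u ue).
  - exact: eo.
have basis_e : basis_of A [:: x, J x & e].
  rewrite basisEfree; apply/and3P; split.
  (* The vector [x] is not orthogonal to itself but is orthogonal to [J x] and to [e]; likewise
     [J x] is not orthogonal to itself but is orthogonal to [e]. *)
  - rewrite !free_cons (basis_free eb) andbT; apply/andP; split.
      have /subvP sub : (<<J x :: e>> <= orthov b <[x]>)%VS.
        apply/span_subvP => y; rewrite inE mem_orthov1.
        case/predU1P=> [->|/e_perp[]].
          by rewrite Jxx.
        by move=> _ ->.
      by apply: contra xx => /sub; rewrite mem_orthov1.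
    rewrite (span_basis eb) mem_perp JxJx (negPf xx).
    by rewrite !andbF.
  - apply/span_subvP => y; rewrite !inE => /or3P[/eqP->|/eqP->|/e_perp[]] //.
  - apply: leq_trans (dim_span _); apply/dimvS/subvP => a aA.
    (* Coefficients of the orthogonal projection of [a] onto the plane of [x] and [J x]; the
       denominators agree because [x] and [J x] have equal norm. *)
    pose c := b a x / b x x; pose d := b a (J x) / b x x.
    rewrite -[a](subrK (c *: x + d *: J x)) addrC.
    rewrite !span_cons addvA memv_add //.
      by rewrite memv_add // memvZ ?memv_line.
    rewrite (span_basis eb) mem_perp; apply/and3P; split.
    + by rewrite rpredB // rpredD // rpredZ.
    + by rewrite linearBl linearDl !linearZl_LR /= Jxx mulr0 addr0 divfK ?subrr.
    + rewrite linearBl linearDl !linearZl_LR /= JxJx skew_norm0 mulr0 add0r.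
      by rewrite divfK ?subrr.
case: (ltgtP (b x x) 0) (xx) => // bx _.
- exists p, q.+1; split=> //=; rewrite ?JxJx ?ep ?eq ?bx ?(lt_gtF bx) //.
  by rewrite mulnS.
- exists p.+1, q; split=> //=; rewrite ?JxJx ?ep ?eq ?bx ?(lt_gtF bx) //.
  by rewrite mulnS.
Qed.

(** The positive and negative counts are even and so is the dimension, hence the null count is even
    too. *)
Lemma has_signature_even : exists p s q : nat,
  has_signature b (2 * p) (2 * s) (2 * q) /\
  (2 * s)%N = \dim (orthov b fullv).
Proof.
have [e [p [q [eb eo ep eq]]]] := orth_basis_even (subvf (J @: fullv)).
have [m dimW] := complex_structure_dim.
have cnt : (2 * p + count (fun x => (b x x == 0)%R) e + 2 * q = 2 * m)%N.
  rewrite -dimW -(span_basis eb) (eqP (basis_free eb)) -ep -eq.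
  elim: e {eb eo ep eq} => //= x e <-.
  by case: (ltgtP (b x x) 0) => _; lia.
have cnt0 : count (fun x => b x x == 0) e = (2 * (m - p - q))%N by lia.
exists p, (m - p - q)%N, q; split; last by rewrite (dim_radical_orth_basis eb).
by exists e.
Qed.

End ComplexStructure.

(** * Pointwise nondegeneracy, restriction, trace, alternating forms *)

Lemma nondegenerateP (R : realType) (W : vectType R) (eps : bool)
    (b : {hermitian W for eps & idfun}) :
  nondegenerate b <-> (forall x, (forall y, b x y = 0) -> x = 0).
Proof.
split=> [/eqP rad0 x bx0|b_nd].
  apply/eqP; rewrite -memv0 -rad0; apply/mem_orthovP => y _; exact: bx0.
rewrite /nondegenerate -subv0; apply/subvP => x /mem_orthovP bx0.
by rewrite memv0; apply/eqP/b_nd => y; rewrite bx0 ?memvf.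
Qed.

Lemma inclE (R : realType) (W : vectType R) (U : {vspace W}) x :
  incl U x = vsval x.
Proof. by rewrite lfunE. Qed.

Lemma restrE (R : realType) (W : vectType R) (U : {vspace W})
    (b : W -> W -> R) x y : restr U b x y = b (vsval x) (vsval y).
Proof. by rewrite /pullback !inclE. Qed.

(** Basis independence of the trace: [a] is factored as [a] after the identity through the basis
    [e], and the two matrices commute under [\tr]. *)
Lemma lftrace_basis (R : realType) (H : vectType R) n (e : n.-tuple H)
    (a : 'End(H)) : basis_of fullv e ->
  lftrace a = \sum_(i < n) coord e i (a e`_i).
Proof.
move=> e_basis; have En := size_basis e_basis.
case: n / En e e_basis => e eb; have vb := vbasisP {:H}.
transitivity (\tr (mxof e e a)); last first.
  by apply: eq_bigr => i _; rewrite !mxE /= vecof_delta.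
rewrite /lftrace -[X in mxof (vbasis _) _ X](comp_lfun1r a).
rewrite (mxof_comp _ _ eb) mxtrace_mulC -(mxof_comp _ _ vb) comp_lfun1l.
by [].
Qed.

Lemma skew_formC (R : realType) (W : vectType R) (w : {skew_symmetric W}) x y :
  w x y = - w y x.
Proof. by rewrite hermC expr1 mulN1r. Qed.

Lemma skew_form_diag (R : realType) (W : vectType R) (w : {skew_symmetric W}) x :
  w x x = 0.
Proof. by have := skew_formC w x x; lra. Qed.

(** * The plane [H] in a symplectic basis *)

Section SymplecticPlane.
Variables (R : realType) (H : vectType R) (wH : {skew_symmetric H}) (h1 h2 : H).
Hypothesis h_basis : symplectic_basis wH h1 h2.

Lemma symplectic_basis_coord x : x = wH x h2 *: h1 + wH h1 x *: h2.
Proof.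
case: h_basis => hb h12.
have : x \in <<[:: h1; h2]>>%VS by rewrite (span_basis hb) memvf.
rewrite span_cons span_seq1 => /memv_addP[_ /vlineP[a ->] [_ /vlineP[b ->] ->]].
rewrite linearDl linearDr !linearZl_LR !linearZr_LR /= !skew_form_diag h12.
by rewrite !mulr0 !mulr1 addr0 add0r.
Qed.

Lemma lftrace_symplectic_basis (a : 'End(H)) :
  lftrace a = wH (a h1) h2 + wH h1 (a h2).
Proof.
case: h_basis => hb h12.
have tb : basis_of fullv [tuple h1; h2] by [].
rewrite (lftrace_basis a tb) !big_ord_recl big_ord0 addr0 /=.
have h12_coord v : v = coord [tuple h1; h2] ord0 v *: h1 +
    coord [tuple h1; h2] (lift ord0 ord0) v *: h2.
  by rewrite {1}(coord_basis tb (memvf v)) !big_ord_recl big_ord0 addr0.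
rewrite {2}(h12_coord (a h1)) {2}(h12_coord (a h2)).
rewrite linearDl linearDr !linearZl_LR !linearZr_LR /= !skew_form_diag h12.
by rewrite !mulr0 !mulr1 addr0 add0r.
Qed.

Lemma symplectic_basis_lfun v1 v2 : exists a : 'End(H), a h1 = v1 /\ a h2 = v2.
Proof.
case: h_basis => hb h12.
have [f] := linear_of_free [:: h1; h2] [:: v1; v2].
case/(_ (basis_free hb) erefl) => f1 f2.
by exists (linfun f); rewrite !lfunE.
Qed.

End SymplecticPlane.

(** * Coordinates on the tensor product *)

Section TensorProduct.
Variables (R : realType) (H E V : vectType R).
Variables (wH : {skew_symmetric H}) (wE : {skew_symmetric E}).
Variables (t : {bilinear H -> E -> V}) (g : {symmetric V}) (h1 h2 : H).
Hypothesis wE_nondeg : nondegenerate wE.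
Hypothesis gE : forall h e h' e', g (t h e) (t h' e') = wH h h' * wE e e'.
Hypothesis h_basis : symplectic_basis wH h1 h2.
Variables (p1 p2 : 'Hom(V, E)).
Hypothesis p12 : forall X, X = t h1 (p1 X) + t h2 (p2 X).

Let vec e e' := t h1 e + t h2 e'.

Let vecD x y x' y' : vec x y + vec x' y' = vec (x + x') (y + y').
Proof. by rewrite /vec !linearDr addrACA. Qed.

Let vecZ a x y : a *: vec x y = vec (a *: x) (a *: y).
Proof. by rewrite /vec !linearZr_LR scalerDr. Qed.

Let vec0 : vec 0 0 = 0.
Proof. by rewrite /vec !linear0r addr0. Qed.

Lemma metric_coord x y x' y' :
  g (t h1 x + t h2 y) (t h1 x' + t h2 y') = wE x y' - wE y x'.
Proof.
have [_ h12] := h_basis.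
rewrite !linearDl !linearDr /= !gE !skew_form_diag h12 (skew_formC _ h2) h12.
by ring.
Qed.

(** Uniqueness of the decomposition that [p12] provides: pairing with [t h2 z] under [g] reads off
    [wE x z], and [wE] is nondegenerate. *)
Lemma p1_vec x y : p1 (t h1 x + t h2 y) = x.
Proof.
apply/eqP; rewrite -subr_eq0; apply/eqP.
apply: (proj1 (nondegenerateP wE) wE_nondeg) => z; rewrite linearBl /=.
have := metric_coord x y 0 z; rewrite [X in g X](p12 (t h1 x + t h2 y)).
by rewrite metric_coord !linear0r !subr0 => ->; rewrite subrr.
Qed.

Lemma p2_vec x y : p2 (t h1 x + t h2 y) = y.
Proof.
apply/eqP; rewrite -subr_eq0; apply/eqP.
apply: (proj1 (nondegenerateP wE) wE_nondeg) => z; rewrite linearBl /=.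
have := metric_coord x y z 0; rewrite [X in g X](p12 (t h1 x + t h2 y)).
by rewrite metric_coord !linear0r !add0r => /oppr_inj->; rewrite subrr.
Qed.

Let vec_inj x y x' y' : vec x y = vec x' y' -> x = x' /\ y = y'.
Proof.
by move=> xy; split; [have := congr1 p1 xy|have := congr1 p2 xy];
  rewrite /vec ?p1_vec ?p2_vec.
Qed.

Let tensor_coord h e :
  t h e = t h1 (wH h h2 *: e) + t h2 (wH h1 h *: e).
Proof.
rewrite [in LHS](symplectic_basis_coord h_basis h) linearDl !linearZl_LR.
by rewrite !linearZr_LR.
Qed.

(** The matrix of the factor on [H] is [[a, c], [b, -a]]; trace zero is the condition that its
    diagonal entries be opposite. *)
Lemma in_QtildeP (A : 'End(V)) : in_Qtilde t A <->
  exists a b c, forall x y, A (t h1 x + t h2 y) =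
    t h1 (a *: x + c *: y) + t h2 (b *: x - a *: y).
Proof.
split=> [[l l_tr Al]|[a [b [c Aabc]]]].
  exists (wH (l h1) h2), (wH h1 (l h1)), (wH (l h2) h2) => x y.
  have := lftrace_symplectic_basis h_basis l; rewrite l_tr => /esym/eqP.
  rewrite addr_eq0 => /eqP tr0; rewrite linearD /= !Al.
  rewrite (tensor_coord (l h1)) (tensor_coord (l h2)) addrACA -!linearDr.
  by rewrite tr0 !scaleNr opprK.
have [l [l1 l2]] := symplectic_basis_lfun h_basis
  (a *: h1 + b *: h2) (c *: h1 - a *: h2).
have [_ h12] := h_basis.
exists l.
  rewrite (lftrace_symplectic_basis h_basis) l1 l2 linearDl linearBr.
  rewrite !linearZl_LR !linearZr_LR /= !skew_form_diag h12.
  by rewrite !mulr1 !mulr0 addr0 add0r subrr.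
move=> h e; rewrite [in LHS]tensor_coord Aabc [in RHS]tensor_coord.
have -> : l h = wH h h2 *: (a *: h1 + b *: h2) + wH h1 h *: (c *: h1 - a *: h2).
  rewrite [in LHS](symplectic_basis_coord h_basis h) linearD /=.
  by rewrite 2!linearZ /= l1 l2.
do 2!rewrite !(linearDl, linearDr, linearNl, linearNr) /= !linearZl_LR
  !linearZr_LR /=.
rewrite !skew_form_diag h12.
rewrite !(mulr0, mulr1, addr0, add0r, subr0, sub0r) !scalerA !scalerDl.
by rewrite mulrN scaleNr ![_ * wH _ _]mulrC.
Qed.

(** * The complex structure [I] in coordinates *)

Variable I : 'End(V).
Hypothesis I_h1 : forall e, I (t h1 e) = t h2 e.
Hypothesis I_h2 : forall e, I (t h2 e) = - t h1 e.

Lemma I_vec x y : I (t h1 x + t h2 y) = t h1 (- y) + t h2 x.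
Proof. by rewrite linearD /= I_h1 I_h2 linearNr addrC. Qed.

Lemma I_coord X : I X = t h1 (- p2 X) + t h2 (p1 X).
Proof. by rewrite {1}(p12 X) I_vec. Qed.

Lemma I_complex : complex_structure I.
Proof.
apply/lfunP => X; rewrite comp_lfunE opp_lfunE id_lfunE (p12 X) !I_vec.
by rewrite !linearNr opprD.
Qed.

Lemma I_skew X Y : g (I X) Y = - g X (I Y).
Proof.
rewrite [X in g (I X)](p12 X) [Y in g _ Y](p12 Y) [X in g X (I _)](p12 X).
rewrite [Y in g _ (I Y)](p12 Y) !I_vec !metric_coord linearNl linearNr /=; ring.
Qed.

(** * Pure complex subspaces are graphs *)

Section PureComplex.
Variable U : {vspace V}.
Hypothesis U_pure : pure t U.
Hypothesis U_cplx : complex_subspace U I.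

Let I_U u : u \in U -> I u \in U.
Proof. by move=> uU; apply/(subvP U_cplx)/memv_img. Qed.

(* A vector [h2 (x) e] of [U] and its image under [I] span [H (x) e]. *)
Lemma pure_p1_inj u : u \in U -> p1 u = 0 -> u = 0.
Proof.
move=> uU p1u; have uE : u = t h2 (p2 u).
  by rewrite {1}(p12 u) p1u linear0r add0r.
pose W := <<[:: t h1 (p2 u); t h2 (p2 u)]>>%VS.
suff W0 : W = 0%VS.
  by apply/eqP; rewrite -memv0 -W0 uE memv_span // !inE eqxx orbT.
apply: U_pure.
  apply/span_subvP => x; rewrite !inE => /orP[|] /eqP->; last by rewrite -uE.
  by rewrite -[t h1 _]opprK -I_h2 -uE rpredN I_U.
move=> A /in_QtildeP[a [b [c Aabc]]]; rewrite limg_span /=.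
have tW1 : t h1 (p2 u) \in W by rewrite memv_span // inE eqxx.
have tW2 : t h2 (p2 u) \in W by rewrite memv_span // !inE eqxx orbT.
apply/span_subvP => x; rewrite !inE => /orP[|] /eqP->.
  have := Aabc (p2 u) 0; rewrite linear0r addr0 => ->.
  by rewrite !scaler0 addr0 subr0 !linearZr_LR rpredD ?rpredZ.
have := Aabc 0 (p2 u); rewrite linear0r add0r => ->.
by rewrite !scaler0 !add0r -scaleNr !linearZr_LR rpredD ?rpredZ.
Qed.

(** Purity makes [p1] injective on [U], so [U] is the graph over [p1 @: U] of [p2] composed with the
    inverse of this restriction. *)
Lemma pure_complex_UFT : exists (F : {vspace E}) (T : 'End(subvs_of F)),
  [/\ F = (p1 @: U)%VS, complex_structure T & U = UFT t h1 h2 (ambient T)].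
Proof.
pose F := (p1 @: U)%VS; pose q := (p1 \o incl U)%VF.
have q_ker : lker q == 0%VS.
  rewrite -subv0; apply/subvP => x; rewrite memv_ker comp_lfunE inclE memv0.
  by move=> /eqP /(pure_p1_inj (subvsP x)) x0; apply/eqP/val_inj.
(* The second coordinate of [u] is the first coordinate of [- I u], which lies in [U]. *)
have p2F u : u \in U -> p2 u \in F.
  move=> uU; apply/memv_imgP; exists (- I u); first by rewrite rpredN I_U.
  by rewrite linearN /= I_coord p1_vec opprK.
pose T : 'End(subvs_of F) :=
  (linfun (vsproj F) \o p2 \o incl U \o q^-1 \o incl F)%VF.
have TE u f : u \in U -> vsval f = p1 u -> vsval (T f) = p2 u.
  move=> uU fu; rewrite !comp_lfunE !inclE lfunE fu.
  have -> : p1 u = q (vsproj U u) by rewrite comp_lfunE inclE vsprojK.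
  by rewrite lker0_lfunK // vsprojK // vsprojK // p2F.
have F_ex (f : subvs_of F) : exists2 u, u \in U & vsval f = p1 u.
  by have /memv_imgP := subvsP f.
exists F, T; split=> //.
  apply/lfunP => f; apply: val_inj; have [u uU fu] := F_ex f.
  (* As a point of the graph, [- I u] shows that [T] sends [p2 u] to [- p1 u]. *)
  have IuE : - I u = t h1 (p2 u) + t h2 (- p1 u).
    by rewrite I_coord !linearNr opprD opprK.
  rewrite comp_lfunE opp_lfunE id_lfunE.
  change (vsval (T (T f)) = - vsval f).
  rewrite (TE (- I u)) ?rpredN ?I_U //; first by rewrite IuE p2_vec fu.
  by rewrite (TE u) // IuE p1_vec.
apply/eqP; rewrite eqEsubv; apply/andP; split; apply/subvP => u.
  move=> uU; apply/memv_imgP; exists (vsproj F (p1 u)); first exact: memvf.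
  have fu : vsval (vsproj F (p1 u)) = p1 u by rewrite vsprojK // memv_img.
  by rewrite phi_mapE comp_lfunE inclE (TE u) // fu -p12.
case/memv_imgP => f _ ->; have [v vU fv] := F_ex f.
by rewrite phi_mapE comp_lfunE inclE (TE v) // fv -p12.
Qed.

End PureComplex.

(** * Graphs of complex structures and the isomorphism [phi] *)

Section GraphSubspace.
Variables (F : {vspace E}) (T : 'End(subvs_of F)).
Hypothesis T_cplx : complex_structure T.

Let U := UFT t h1 h2 (ambient T).
Let phi := phi_map t h1 h2 (ambient T).
Let gF := pullback phi g.
Let wF := restr F wE.

Lemma phi_ambientE f : phi f = t h1 (vsval f) + t h2 (vsval (T f)).
Proof. by rewrite phi_mapE comp_lfunE inclE. Qed.

Lemma phi_U f : phi f \in U.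
Proof. exact/memv_img/memvf. Qed.

Lemma U_phi u : u \in U -> exists f, u = phi f.
Proof. by case/memv_imgP => f _ ->; exists f. Qed.

(** Since [T (- T f) = f], the swap of coordinates done by [I] stays in the graph. It corresponds to
    [- T], that is [T^-1], which explains the inverse in (a). *)
Lemma I_phi f : I (phi f) = phi (- T f).
Proof.
rewrite !phi_ambientE I_vec [T (- _)]linearN /= (complex_structureE T_cplx).
by rewrite opprK.
Qed.

Lemma UFT_complex : complex_subspace U I.
Proof.
by apply/subvP => _ /memv_imgP[u /U_phi[f ->] ->]; rewrite I_phi phi_U.
Qed.

(* The nilpotent [h1 |-> h2, h2 |-> 0] maps [phi f] to [h2 (x) f], which lies
   outside [U] unless [f = 0]. *)
Lemma UFT_pure : pure t U.
Proof.
move=> W WU W_pq; apply/eqP; rewrite -subv0; apply/subvP => x xW.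
have [f xf] := U_phi (subvP WU _ xW).
have [l [l1 l2]] := symplectic_basis_lfun h_basis h2 0.
have [A A_Q Af] : exists2 A, in_Qtilde t A & A (phi f) = t h2 (vsval f).
  exists (linfun (t h2) \o p1)%VF.
    apply/in_QtildeP; exists 0, 1, 0 => y z.
    rewrite comp_lfunE lfunE p1_vec /= !scale0r scale1r addr0 subr0.
    by rewrite linear0r add0r.
  by rewrite comp_lfunE lfunE phi_ambientE p1_vec.
have : A x \in U by apply/(subvP WU)/(subvP (W_pq A A_Q))/memv_img.
rewrite xf Af => /U_phi[f' Afx]; have := congr1 p1 Afx.
rewrite phi_ambientE p1_vec.
have fE : t h2 (vsval f) = t h1 0 + t h2 (vsval f) by rewrite linear0r add0r.
rewrite {1}fE p1_vec => f'0; have {}f'0 : f' = 0 by apply: val_inj.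
have := congr1 p2 Afx; rewrite phi_ambientE f'0 fE !p2_vec => f0.
have -> : f = 0 by apply: val_inj; rewrite /= f0 !linear0.
by rewrite linear0 mem0v.
Qed.

Lemma phi_lker : lker phi = 0%VS.
Proof.
apply/eqP; rewrite -subv0; apply/subvP => f; rewrite memv_ker memv0 => /eqP.
move/(congr1 p1); rewrite phi_ambientE p1_vec linear0 => f0.
by apply/eqP/val_inj.
Qed.

Lemma phi_complex_iso : complex_iso (T^-1)%VF U I phi.
Proof.
rewrite (complex_structure_inv T_cplx); split=> //.
- apply/lfunP => f; rewrite comp_lfunE !opp_lfunE linearN opprK id_lfunE /=.
  exact: complex_structureE.
- by split; [exact: I_complex|exact: UFT_complex].
- exact: phi_lker.
- by move=> f; rewrite opp_lfunE I_phi.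
Qed.

(** * Induced metric, Kaehler form and signature *)

Lemma gFE f f' :
  gF f f' = wE (vsval f) (vsval (T f')) - wE (vsval (T f)) (vsval f').
Proof. by rewrite /gF /pullback !phi_ambientE metric_coord. Qed.

Lemma gF_Tinv f f' :
  form_comp gF (T^-1)%VF f f' = - (wF f f' + wF (T f) (T f')).
Proof.
rewrite /form_comp (complex_structure_inv T_cplx) opp_lfunE gFE.
rewrite [T (- _)]linearN /= (complex_structureE T_cplx) opprK linearNl /= /wF !restrE; ring.
Qed.

Lemma kaehler_form f f' :
  pullback phi (form_comp g I) f f' = form_comp gF (T^-1)%VF f f'.
Proof.
have [_ _ _ _ phiI] := phi_complex_iso.
by rewrite /form_comp /gF /pullback phiI.
Qed.

(** By [gF_Tinv] the form [gF (T^-1 f) f'] is antisymmetric in [f] and [f']; symmetry of [gF] turns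
    this into skewness of [T^-1]. *)
Lemma gF_skew : skew_for gF (T^-1)%VF.
Proof.
move=> f f'; have := gF_Tinv f f'; have := gF_Tinv f' f.
rewrite /form_comp /wF !restrE => + ->.
rewrite {1}/gF /pullback (sym_formC g) -/(pullback phi g _ _) -/gF => ->.
by rewrite (skew_formC wE (vsval f')) (skew_formC wE (vsval (T f'))); ring.
Qed.

(** Radicals correspond under the bijection [phi]; [vsproj U] lifts [phi f] to the type
    [subvs_of U]. *)
Lemma hermitian_UFT : hermitian_subspace g U I <-> nondegenerate gF.
Proof.
split=> [[_ /nondegenerateP gU]|/nondegenerateP gF_nd].
  apply/nondegenerateP => f gf0.
  have fU : vsval (vsproj U (phi f)) = phi f by rewrite vsprojK // phi_U.
  have phif0 : vsproj U (phi f) = 0.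
    apply: gU => y; have [f' yf'] := U_phi (subvsP y).
    by rewrite /= restrE fU yf'; apply: gf0.
  apply/eqP; rewrite -memv0 -phi_lker memv_ker -fU phif0 linear0 //.
split; first exact: UFT_complex.
apply/nondegenerateP => y gy0; have [f yf] := U_phi (subvsP y).
suff f0 : f = 0 by apply: val_inj; rewrite /= yf f0 linear0.
apply: gF_nd => f'; have := gy0 (vsproj U (phi f')).
by rewrite /= restrE vsprojK ?phi_U // yf.
Qed.

Lemma phi_hermitian_iso :
  hermitian_subspace g U I -> hermitian_iso (T^-1)%VF gF U I g phi.
Proof.
move=> UH; split=> //; first exact: phi_complex_iso.
- by split; [apply/hermitian_UFT|exact: gF_skew].
- by split=> // X Y _ _; apply: I_skew.
Qed.

Lemma UFT_signature : exists p s q : nat,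
  has_signature (restr U g) (2 * p) (2 * s) (2 * q) /\
  (2 * s)%N = \dim (kernel_on U g).
Proof.
(* This is [I] as an endomorphism of [subvs_of U]: the projection is the identity on [I @: U], which
   lies in [U]. *)
pose J : 'End(subvs_of U) := (linfun (vsproj U) \o I \o incl U)%VF.
have JE x : vsval (J x) = I (vsval x).
  rewrite !comp_lfunE inclE lfunE vsprojK //.
  by apply/(subvP UFT_complex)/memv_img/subvsP.
apply: (@has_signature_even _ _ J).
  apply/lfunP => x; apply: val_inj; rewrite comp_lfunE opp_lfunE id_lfunE.
  change (vsval (J (J x)) = - vsval x).
  by rewrite !JE (complex_structureE I_complex).
by move=> x y; rewrite /= !restrE !JE I_skew.
Qed.

(** * Skewness of [T] and totally complex subspaces *)

Lemma skew_wF_isom : skew_for wF T <-> (forall f f', wF f f' = wF (T f) (T f')).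
Proof.
(* Each condition at [T f'] gives the other at [f'], because [T (T f') = - f']. *)
split=> [wT f f'|wT f f'].
  have := wT f (T f'); rewrite (complex_structureE T_cplx) /wF !restrE /=.
  by rewrite linearNr opprK.
have := wT f (T f'); rewrite (complex_structureE T_cplx) /wF !restrE /=.
by rewrite linearNr /= => ->; rewrite opprK.
Qed.

Lemma skew_wF_gF :
  skew_for wF T <-> (forall f f', gF f f' = - 2 * form_comp wF T f f').
Proof.
split=> wT f f'; have := wT f f'; rewrite gFE /form_comp /wF !restrE; lra.
Qed.

(** Here [gF] is [- 2] times [wF] composed with the invertible [T], and skewness moves [T] to the
    other argument, so the two radicals coincide. *)
Lemma skew_wF_nondegenerate :
  skew_for wF T -> nondegenerate gF <-> nondegenerate wF.
Proof.
move=> wT; have gwF := proj1 skew_wF_gF wT.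
split=> /nondegenerateP nd; apply/nondegenerateP => f f0.
  have {}f0 y : wF f y = 0 := f0 y.
  by apply: nd => f'; rewrite -[LHS]/(gF f f') gwF /form_comp wT f0 oppr0 mulr0.
have {}f0 y : gF f y = 0 := f0 y.
apply: nd => f'; rewrite -[LHS]/(wF f f'); have := gwF f (- T f').
rewrite f0 /form_comp wT [T (- _)]linearN /= (complex_structureE T_cplx) opprK.
lra.
Qed.

(* An admissible [J] acts on [H] by [[a, b], [b, -a]] with [a^2 + b^2 = 1]; the
   condition [JU _|_ U] at [f] and at [T f] is a linear system in the two
   obstructions to [T] being skew and isometric, of determinant [a^2 + b^2]. *)
Lemma totally_complex_skew : (exists e : E, e != 0) ->
  totally_complex t g U I -> skew_for wF T.
Proof.
move=> [e0 e0N0] [_ [J [K [[[_ Q_span] [IJ _ _] [_ J2 _] _] JU]]]].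
have /Q_span/in_QtildeP[a [b [c Jabc]]] : J \in <<[:: I; J; K]>>%VS.
  by rewrite memv_span // !inE eqxx orbT.
(* Anticommutation with [I] makes the matrix of [J] symmetric; first coordinates at a nonzero [e0]
   suffice to see it. *)
have bc : c = b.
  have /lfunP/(_ (vec e0 0))/(congr1 p1) := IJ.
  rewrite opp_lfunE linearN !comp_lfunE /= /vec I_vec !Jabc I_vec !p1_vec.
  rewrite oppr0 !scaler0 add0r subr0 => /oppr_inj/eqP.
  rewrite -subr_eq0 -scalerBl scaler_eq0 (negPf e0N0) orbF subr_eq0.
  by move=> /eqP.
have ab1 : a ^+ 2 + b ^+ 2 = 1.
  have /lfunP/(_ (vec e0 0)) := J2; rewrite comp_lfunE id_lfunE /vec !Jabc.
  case/vec_inj => /eqP + _; rewrite !(scaler0, addr0, subr0) bc !scalerA.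
  rewrite -scalerDl -subr_eq0 -{2}[e0]scale1r -scalerBl scaler_eq0.
  by rewrite (negPf e0N0) orbF subr_eq0 => /eqP.
have JU0 f f' : a * (wF f (T f') + wF (T f) f') +
    b * (wF (T f) (T f') - wF f f') = 0.
  have := orthovP JU (J (phi f)) (phi f') (memv_img _ (phi_U f)) (phi_U f').
  rewrite !phi_ambientE Jabc metric_coord bc /wF !restrE.
  rewrite linearDl linearBl !linearZl_LR /= => <-; ring.
move=> f f'; have := JU0 f f'; have := JU0 (T f) f'.
rewrite (complex_structureE T_cplx) /wF !restrE !linearNl /=.
move: (wE _ (vsval f')) (wE _ (vsval (T f'))) (wE _ _) (wE _ _) => x y z u.
move=> eq2 eq1; apply/eqP; rewrite -addr_eq0 -[_ + _]mul1r -ab1; apply/eqP.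
(* With S = y + x and D = u - z, the two equations read aS + bD = 0 and aD - bS = 0; a times the
   first minus b times the second is (a^2 + b^2)S. *)
transitivity
  (a * (a * (y + x) + b * (u - z)) - b * (a * (u - z) + b * (- y - x))).
  by ring.
by rewrite eq1 eq2 !mulr0 subr0.
Qed.

Lemma skew_totally_complex : (exists e : E, e != 0) ->
  hermitian_subspace g U I -> skew_for wF T -> totally_complex t g U I.
Proof.
(* [J] and [K] act on [H] by [diag(1, -1)] and by the exchange of [h1], [h2]. *)
move=> [e0 e0N0] UH wT; split=> //.
pose J : 'End(V) := ((linfun (t h1) \o p1) - (linfun (t h2) \o p2))%VF.
have J_vec x y : J (t h1 x + t h2 y) = t h1 x + t h2 (- y).
  by rewrite add_lfunE opp_lfunE !comp_lfunE !lfunE /= p1_vec p2_vec linearNr.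
pose K := (I \o J)%VF.
have K_vec x y : K (t h1 x + t h2 y) = t h1 y + t h2 x.
  by rewrite comp_lfunE J_vec I_vec opprK.
have vecP (A B : 'End(V)) : (forall x y, A (vec x y) = B (vec x y)) -> A = B.
  by move=> AB; apply/lfunP => X; rewrite (p12 X) AB.
exists J, K; split; last first.
  (* For this [J] the pairing of [J (phi f)] with [phi f'] is [wF f (T f') + wF (T f) f'], which is
     zero by skewness. *)
  apply/orthovP => _ v /memv_imgP[_ /U_phi[f ->] ->] /U_phi[f' ->].
  rewrite !phi_ambientE J_vec metric_coord linearNl /= opprK.
  have := wT f f'; rewrite /wF !restrE => ->; exact: addrN.
have IJK : (I \o I = - \1 /\ J \o J = \1 /\ K \o K = \1)%VF.
  split; first exact: I_complex.
  by split; apply: vecP => x y; rewrite comp_lfunE id_lfunE /vec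
    ?J_vec ?K_vec ?J_vec ?K_vec ?opprK.
have comboE k0 k1 k2 x y : (k0 *: I + k1 *: J + k2 *: K) (vec x y) =
    vec (k1 *: x + (k2 - k0) *: y) ((k0 + k2) *: x - k1 *: y).
  rewrite !add_lfunE !scale_lfunE /vec I_vec J_vec K_vec !vecZ !vecD.
  congr vec; rewrite !scalerN; last by rewrite scalerDl addrAC.
  by rewrite scalerBl [- _ + _]addrC -addrA [- _ + _]addrC.
split.
- split.
    change (free [tuple I; J; K]); apply/freeP => k.
    rewrite !big_ord_recl big_ord0 addr0 addrA /=.
    set k0 := k _; set k1 := k _; set k2 := k _ => IJK0.
    have kE x y : vec (k1 *: x + (k2 - k0) *: y) ((k0 + k2) *: x - k1 *: y) =
      vec 0 0 by rewrite -comboE IJK0 zero_lfunE vec0.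
    (* The values at (e0, 0) and (0, e0) give k1 = 0, k0 + k2 = 0 and k2 - k0 = 0. *)
    have [] := vec_inj (kE e0 0); rewrite !scaler0 addr0 subr0 => /eqP + /eqP.
    have [+ _] := vec_inj (kE 0 e0); rewrite scaler0 add0r => /eqP.
    rewrite !scaler_eq0 (negPf e0N0) !orbF => /eqP k20 /eqP k1_0 /eqP k02.
    move=> i; case: (unliftP ord0 i) => [j|] ->; last by rewrite -/k0; lra.
    case: (unliftP ord0 j) => [l|] ->; last by rewrite -/k1.
    by rewrite [l]ord1 -/k2; lra.
  move=> A; split.
    rewrite !span_cons span_nil addv0.
    move=> /memv_addP[_ /vlineP[k0 ->] [_ /memv_addP[_ /vlineP[k1 ->]
      [_ /vlineP[k2 ->] ->]] ->]].
    apply/in_QtildeP; exists k1, (k0 + k2), (k2 - k0) => x y.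
    by rewrite addrA comboE.
  case/in_QtildeP => a [b [c Aabc]].
  (* The solution of k1 = a, k0 + k2 = b, k2 - k0 = c, from [comboE]. *)
  have -> : A = ((b - c) / 2) *: I + a *: J + ((b + c) / 2) *: K.
    apply: vecP => x y; rewrite /vec Aabc -/(vec x y) comboE.
    by congr (t h1 (_ + _ *: _) + t h2 (_ *: _ - _)); field.
  by rewrite !rpredD // rpredZ // memv_span // !inE eqxx ?orbT.
- split; apply: vecP => x y; rewrite opp_lfunE !comp_lfunE /vec;
  rewrite ?K_vec ?J_vec ?I_vec ?K_vec ?J_vec ?I_vec ?K_vec ?J_vec;
  by rewrite !linearNr ?opprD ?opprK.
- by case: IJK => ? [? ?]; split.
- by [].
Qed.

End GraphSubspace.
End TensorProduct.

(** * Characterization of pure complex subspaces and their invariants *)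

Theorem theorem3p16 (R : realType) (n : nat) (H E V : vectType R)
  (wH : {skew_symmetric H}) (wE : {skew_symmetric E})
  (t : {bilinear H -> E -> V}) (g : {symmetric V})
  (n_gt0 : (0 < n)%N)
  (dimH : \dim {:H} = 2%N) (dimE : \dim {:E} = (2 * n)%N)
  (wH_sympl : is_psymplectic wH) (wE_sympl : is_psymplectic wE)
  (t_tensor : is_tensor t)
  (gE : forall h e h' e', g (t h e) (t h' e') = wH h h' * wE e e')
  (I : 'End(V)) (I_compat : compatible_complex_structure t I)
  (h1 h2 : H) (h_basis : symplectic_basis wH h1 h2)
  (I_h1 : forall e, I (t h1 e) = t h2 e)
  (I_h2 : forall e, I (t h2 e) = - t h1 e)
  (p1 p2 : 'Hom(V, E))
  (p12 : forall X, X = t h1 (p1 X) + t h2 (p2 X))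
  (U : {vspace V}) :
  ((pure t U /\ complex_subspace U I) <->
   exists (F : {vspace E}) (T : 'End(subvs_of F)),
     [/\ F = (p1 @: U)%VS, complex_structure T & U = UFT t h1 h2 (ambient T)])
  /\
  (forall (F : {vspace E}) (T : 'End(subvs_of F)),
     F = (p1 @: U)%VS -> complex_structure T -> U = UFT t h1 h2 (ambient T) ->
     let phi := phi_map t h1 h2 (ambient T) in
     let gF := pullback phi g in
     let wF := restr F wE in
     let Tinv := (T^-1)%VF in
     [/\ (* (a) *)
         complex_iso Tinv U I phi,
         (* (b) *)
         [/\ exists p s q : nat,
               has_signature (restr U g) (2 * p) (2 * s) (2 * q) /\
               (2 * s)%N = \dim (kernel_on U g),
             hermitian_subspace g U I <-> nondegenerate gF
           & hermitian_subspace g U I ->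
               hermitian_iso Tinv gF U I g phi /\ skew_for gF Tinv],
         (* (c) *)
         (forall f f',
             pullback phi (form_comp g I) f f' = form_comp gF Tinv f f') /\
         (forall f f', form_comp gF Tinv f f' = - (wF f f' + wF (T f) (T f')))
       & (* (d) *)
         [/\ totally_complex t g U I <-> (nondegenerate wF /\ skew_for wF T),
             skew_for wF T <-> (forall f f', wF f f' = wF (T f) (T f'))
           & skew_for wF T <->
               (forall f f', gF f f' = - 2 * form_comp wF T f f')]]).
Proof.
have [wE_nondeg _ _] := wE_sympl.
(* A nonzero vector of [E] allows matrix entries on [H] to be read off from the action on [V]. *)
have E_neq0 : exists e : E, e != 0.
  exists (vpick {:E}); rewrite vpick0 -dimv_eq0 dimE muln_eq0 /=.
  by rewrite -lt0n.
split; first split.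
- by move=> [U_pure U_cplx];
    apply: (pure_complex_UFT wE_nondeg gE h_basis p12 I_h1 I_h2).
- move=> [F [T [_ T_cplx ->]]]; split.
    exact: (UFT_pure wE_nondeg gE h_basis p12).
  exact: (UFT_complex I_h1 I_h2).
move=> F T _ T_cplx -> /=.
have TC_skew := totally_complex_skew wE_nondeg gE h_basis p12 I_h1 I_h2 T_cplx
  E_neq0.
have skew_TC := @skew_totally_complex _ _ _ _ _ _ _ _ _ _ wE_nondeg gE h_basis
  _ _ p12 _ I_h1 I_h2 F T E_neq0.
have herm := hermitian_UFT wE_nondeg gE h_basis p12 I_h1 I_h2 T_cplx.
have nd := skew_wF_nondegenerate gE h_basis T_cplx.
split.
- exact: (phi_complex_iso wE_nondeg gE h_basis p12).
- split=> //.
    exact: (UFT_signature gE h_basis p12).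
  move=> UH; split; last exact: (gF_skew gE h_basis).
  exact: (phi_hermitian_iso wE_nondeg gE h_basis p12).
- split=> f f'; last exact: (gF_Tinv gE h_basis).
  exact: (kaehler_form wE_nondeg gE h_basis p12).
split; last exact: (skew_wF_gF gE h_basis); last exact: skew_wF_isom.
(* Being totally complex includes being Hermitian, i.e. nondegeneracy of [gF], which skewness of [T]
   converts into nondegeneracy of [wF]. *)
split=> [UTC|[wF_nd wT]].
  have wT := TC_skew UTC; split=> //.
  by apply/nd => //; apply/herm; case: UTC.
by apply: skew_TC => //; apply/herm/nd.
Qed.
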